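(* Let $\alpha<\omega_1$, let $Y_\alpha\subseteq[0,1]$ be a compact countable set of Cantor-Bendixson rank $\alpha$, let $X_\alpha=Y_\alpha\times\{0,1\}$ (as a subspace of $[0,1]^2$), and let $G_\alpha=\mathrm{Homeo}(X_\alpha)$ with the compact-open topology and its natural action on $X_\alpha$. Then $\beta(X_\alpha,G_\alpha)=\alpha$.
   Context: Cantor-Bendixson rank: for a topological space $X$ let $X^1$ be the set of limit points of $X$; set $X^0=X$, $X^{\alpha+1}=(X^\alpha)^1$, and $X^\gamma=\bigcap_{\alpha<\gamma}X^\alpha$ for limit $\gamma$. The Cantor-Bendixson rank of $X$ is the least $\alpha$ with $X^\alpha=X^{\alpha+1}$. The Ellis semigroup $E(X,G)$ of a continuous action of a topological group $G$ on a compact metric space $X$ is the closure of $G$ (identified with $\{x\mapsto gx : g\in G\}$) in $X^X$ with the topology of pointwise convergence. $\beta$-rank: let $(X,G)$ be a tame metric dynamical system (equivalently, every $p\in E(X,G)$ is a Baire class 1 function $X\to X$; this holds for $(X_\alpha,G_\alpha)$). For $p\in E(X,G)$, $A\subseteq X$ and $x\in A$, let $\mathrm{osc}(p,x,A)=\inf\{\mathrm{diam}(p(V\cap A)) : V\text{ an open neighbourhood of }x\}$. For $\varepsilon>0$ let $A^1_{\varepsilon,p}=\{x\in A : \mathrm{osc}(p,x,A)\geq\varepsilon\}$. Iterate over countable ordinals: $A^0_{\varepsilon,p}=A$, $A^{\alpha+1}_{\varepsilon,p}=(A^\alpha_{\varepsilon,p})^1_{\varepsilon,p}$, and $A^\gamma_{\varepsilon,p}=\bigcap_{\alpha<\gamma}A^\alpha_{\varepsilon,p}$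 for limit $\gamma$. Let $\beta(p,\varepsilon)$ be the least $\alpha<\omega_1$ with $X^\alpha_{\varepsilon,p}=\varnothing$ if it exists, and $\omega_1$ otherwise. Let $\beta(p)=\sup_{\varepsilon>0}\beta(p,\varepsilon)$ and $\beta(X,G)=\sup\{\beta(p) : p\in E(X,G)\}$. *)

(* Defs.v *)
From HB Require Import structures.
From mathcomp Require Import all_boot all_order all_algebra.
From mathcomp Require Import all_classical all_reals all_analysis.
From mathcomp Require wochoice.
From mathcomp Require Import ring lra.

Set Implicit Arguments.
Unset Strict Implicit.
Unset Printing Implicit Defensive.

Import Order.TTheory GRing.Theory Num.Theory.
Import numFieldNormedType.Exports.

Local Open Scope classical_set_scope.

(** [Ord] is the set of ordinals up to and including [omega1]. A well-order on
    the uncountable type [set nat] is extended by a top element; the elements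
    all of whose strict predecessors have only countably many predecessors form
    an initial segment of order type [omega1 + 1]. *)

Definition wo : rel (set nat) := sval (wochoice.well_ordering_principle (set nat)).

Definition wole (x y : option (set nat)) : bool :=
  match x, y with
  | _, None => true
  | None, Some _ => false
  | Some a, Some b => wo a b
  end.

Definition wolt x y := wole x y && (x != y).

Lemma wo_least (A : set (option (set nat))) : A !=set0 ->
  exists2 x, A x & forall y, A y -> wole x y.
Proof.
move=> [x0 Ax0].
have [[a Aa]|nA] := pselect (exists a, A (Some a)); last first.
  exists x0 => //; case: x0 Ax0 => [a Aa|A0 [y Ay|//]]; exfalso; apply: nA.
    by exists a.
  by exists y.
have [|b [[Ab bmin] _]] := svalP (wochoice.well_ordering_principle (set nat))
    [pred a | `[< A (Some a) >]].
  by exists a; apply/asboolP.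
exists (Some b); first exact/asboolP.
by move=> [c Ac|//]; apply: bmin; apply/asboolP.
Qed.

Lemma wole_refl : reflexive wole.
Proof. by move=> x; have [|y -> /(_ _ erefl)] := @wo_least [set x]; first by exists x. Qed.

Lemma wole_total : total wole.
Proof.
move=> x y; have [|z] := @wo_least [set x; y]; first by exists x; left.
by move=> [->|->] zmin; apply/orP; [left; apply: zmin; right|right; apply: zmin; left].
Qed.

Lemma wole_anti : antisymmetric wole.
Proof.
move=> [a|] [b|] //= /andP[ab ba]; congr Some.
have [|z [_ zu]] := svalP (wochoice.well_ordering_principle (set nat)) (mem [:: a; b]).
  by exists a; rewrite !inE eqxx.
have waa c : wo c c by exact: (wole_refl (Some c)).
rewrite -(zu a) ?(zu b)//; split; rewrite ?inE ?eqxx ?orbT// => c;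
  by rewrite !inE => /orP[] /eqP ->.
Qed.

Lemma wole_trans : transitive wole.
Proof.
move=> y x z xy yz.
have [|m] := @wo_least [set x; y; z]; first by exists x; left; left.
move=> [[->|my]|mz] mmin; first by apply: mmin; right.
- rewrite my in mmin *; have yx : wole y x by apply: mmin; left; left.
  by rewrite (@wole_anti x y) ?xy.
- have zy : wole z y by rewrite -mz; apply: mmin; left; right.
  by rewrite -(@wole_anti y z) ?yz.
Qed.

Definition Ord : Type :=
  set_type [set x | forall y, wolt y x -> countable [set z | wolt z y]].

HB.instance Definition _ := Choice.on Ord.

Fact ord_display : Order.disp_t. Proof. exact: Order.Disp tt tt. Qed.

Definition ole : rel Ord := [rel x y | wole (val x) (val y)].

Fact ole_refl : reflexive ole. Proof. by move=> x; exact: wole_refl. Qed.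

Fact ole_anti : antisymmetric ole.
Proof. by move=> x y /wole_anti/val_inj. Qed.

Fact ole_trans : transitive ole.
Proof. by move=> x y z; exact: wole_trans. Qed.

Fact ole_total : total ole. Proof. by move=> x y; exact: wole_total. Qed.

HB.instance Definition _ :=
  Order.Le_isPOrder.Build ord_display Ord ole_refl ole_anti ole_trans.
HB.instance Definition _ :=
  Order.POrder_isTotal.Build ord_display Ord ole_total.

Section ordinals.
Local Open Scope order_scope.

Lemma ord_least (A : set Ord) : A !=set0 -> exists2 x, A x & lbound A x.
Proof.
move=> [a Aa].
have [|_ [x Ax <-] xmin] := @wo_least [set val x | x in A].
  by exists (val a), a.
by exists x => // y Ay; apply: xmin; exists y.
Qed.

Lemma ord_wf : well_founded (fun a b : Ord => a < b).
Proof.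
move=> a; apply: contrapT => nacc.
have [|x nx xmin] := @ord_least [set x | ~ Acc (fun a b : Ord => a < b) x].
  by exists a.
apply: nx; constructor => y yx; apply: contrapT => /xmin.
by rewrite leNgt yx.
Qed.

Lemma setnat_uncountable : ~ countable [set: set nat].
Proof.
move/countable_injP => [f finj].
pose D := [set n | exists A, n = f A /\ ~ A n].
have [DD|nDD] := pselect (D (f D)); last by apply: (nDD); exists D.
have [A [/finj E nA]] := DD.
by apply: nA; rewrite -E ?inE.
Qed.

Lemma wolt_val (a b : Ord) : wolt (val a) (val b) = (a < b).
Proof.
by rewrite lt_neqAle andbC /wolt.
Qed.

Lemma wolt_trans x y z : wolt x y -> wolt y z -> wolt x z.
Proof.
move=> /andP[xy nxy] /andP[yz nyz]; rewrite /wolt (wole_trans xy yz)/=.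
apply: contra nxy => /eqP xz; rewrite -xz in yz.
by apply/eqP/wole_anti; rewrite xy.
Qed.

Lemma omega1_subproof : exists w : Ord,
  ~ countable [set a | a < w] /\ forall a, a < w -> countable [set b | b < a].
Proof.
have [|w wunc wmin] := @wo_least [set x | ~ countable [set z | wolt z x]].
  exists None => /= /countable_injP[f finj]; apply: setnat_uncountable.
  apply/countable_injP; exists (f \o Some) => a b _ _ /= fab.
  by have := finj (Some a) (Some b); rewrite !inE => /(_ isT isT fab)[].
have wP y : wolt y w -> countable [set z | wolt z y].
  move=> /andP[yw nyw]; apply: contrapT => /wmin wy.
  by case/eqP: nyw; apply: wole_anti; rewrite yw.
pose w' : Ord := exist _ w (mem_set wP).
exists w'; split.
  have -> : [set a | a < w'] = val @^-1` [set z | wolt z w].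
    by apply/seteqP; split=> a; rewrite /= -wolt_val.
  move=> /countable_injP[f finj]; apply: wunc; apply/countable_injP.
  have zP z : wolt z w -> forall y, wolt y z -> countable [set t | wolt t y].
    by move=> zw y yz; exact: (wP y (wolt_trans yz zw)).
  pose g z := if pselect (wolt z w) is left zw
              then f (exist _ z (mem_set (zP z zw)) : Ord) else 0%N.
  exists g => a b; rewrite !inE /= /g => aw bw.
  case: pselect => // aw'; case: pselect => // bw' /finj; rewrite !inE.
  by move=> /(_ aw bw)/(congr1 val).
move=> a; rewrite -wolt_val => /(wP (val a)).
move=> /countable_injP[f finj]; apply/countable_injP; exists (f \o val).
move=> x y; rewrite !inE /= -!wolt_val => xa ya /finj; rewrite !inE.
by move=> /(_ xa ya)/val_inj.
Qed.

Definition omega1 : Ord := sval (cid omega1_subproof).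

Lemma omega1_uncountable : ~ countable [set a : Ord | a < omega1].
Proof. exact: (svalP (cid omega1_subproof)).1. Qed.

Lemma lt_omega1_countable (a : Ord) : a < omega1 -> countable [set b | b < a].
Proof. exact: (svalP (cid omega1_subproof)).2. Qed.

Lemma le_omega1 (a : Ord) : a <= omega1.
Proof.
rewrite leNgt; apply/negP => wa.
apply: omega1_uncountable.
have := set_mem (svalP a) (val omega1); rewrite wolt_val => /(_ wa).
move=> /countable_injP[f finj]; apply/countable_injP; exists (f \o val).
move=> x y; rewrite !inE /= -!wolt_val => xa ya /finj; rewrite !inE.
by move=> /(_ xa ya)/val_inj.
Qed.

(** The least element of [A]; [omega1] when [A] is empty. *)
Definition least (A : set Ord) : Ord := xget omega1 (A `&` lbound A).

Lemma leastP (A : set Ord) : A !=set0 -> A (least A) /\ lbound A (least A).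
Proof.
move=> /ord_least[x Ax xmin].
by rewrite /least; case: xgetP => [y _ []//|/(_ x)]; case.
Qed.

Lemma least_set0 : least set0 = omega1.
Proof. by rewrite /least; case: xgetP => // y _ []. Qed.

Definition Ord0 : Ord := least setT.

Lemma Ord0_le (a : Ord) : Ord0 <= a.
Proof. by have [|_] := @leastP setT; [exists a|apply]. Qed.

(** The successor; junk value [omega1] at [omega1]. *)
Definition osucc (a : Ord) : Ord := least [set b | a < b].

Lemma osuccP (a b : Ord) : a < omega1 -> (b < osucc a) = (b <= a).
Proof.
move=> aw; have [|/= h1 h2] := @leastP [set b | a < b]; first by exists omega1.
apply/idP/idP => [|/le_lt_trans]; last exact.
by rewrite ltNge; apply: contraNle; exact: h2.
Qed.

Definition is_limit (a : Ord) : Prop :=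
  a <> Ord0 /\ forall d, d < a -> osucc d <> a.

Definition osup (A : set Ord) : Ord := supremum Ord0 A.

Lemma osupP (A : set Ord) : supremums A (osup A).
Proof.
have [|s As smin] := @ord_least (ubound A).
  by exists omega1 => a _; exact: le_omega1.
rewrite /osup /supremum; case: ifPn => [/eqP ->|_].
  by split=> [//|a _]; exact: Ord0_le.
by case: xgetP => [//|/(_ s)]; case.
Qed.

Section titer.
Context {T : Type} (D : set T -> set T) (A : set T).

Definition titer_body (a : Ord) (S : forall d, d < a -> set T) : set T :=
  [set x | [/\ a = Ord0 -> A x,
    forall d (da : d < a), a = osucc d -> D (S d da) x &
    is_limit a -> forall d (da : d < a), S d da x]].

Definition titer : Ord -> set T := Fix ord_wf (fun=> set T) titer_body.

Lemma titerE a : titer a = titer_body (fun d (_ : d < a) => titer d).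
Proof.
rewrite /titer Fix_eq// => {}a f g fg; congr titer_body.
by apply: functional_extensionality_dep => d; apply: funext => da.
Qed.

Lemma titer0 : titer Ord0 = A.
Proof.
rewrite titerE; apply/seteqP; split=> [x [/(_ erefl)]//|x Ax]; split=> //.
- by move=> d; rewrite ltNge Ord0_le.
- by case.
Qed.

Lemma titerS a : a < omega1 -> titer (osucc a) = D (titer a).
Proof.
move=> aw; have aS : a < osucc a by rewrite osuccP.
rewrite [LHS]titerE; apply/seteqP; split=> [x [_ /(_ _ aS erefl)]//|x Dx].
split.
- by move=> a0; move: aS; rewrite a0 ltNge Ord0_le.
- move=> d dS E; have -> // : d = a.
  apply/le_anti; rewrite -osuccP// dS/= -osuccP -?E//.
  exact: lt_le_trans dS (le_omega1 _).
- by move=> [_ /(_ a aS)]; case.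
Qed.

Lemma titer_lim a : is_limit a -> titer a = \bigcap_(d in [set d | d < a]) titer d.
Proof.
move=> al; rewrite [LHS]titerE; apply/seteqP; split=> [x [_ _ /(_ al)]|x Dx].
  by move=> h d da; exact: h.
by split=> // [/al.1//|d da E]; case: (al.2 d da).
Qed.

End titer.

End ordinals.

Local Open Scope ring_scope.

Definition cb_deriv (T : topologicalType) (A : set T) : set T :=
  A `&` limit_point A.

Definition cb_iter (T : topologicalType) : Ord -> set T :=
  titer (@cb_deriv T) setT.

(** Correct whenever the rank is countable; larger ranks are collapsed to
    [omega1]. *)
Definition cb_rank (T : topologicalType) : Ord :=
  least [set a | cb_iter a = cb_iter (osucc a) :> set T].

#[short(type="preTopologicalGroupType")]
HB.structure Definition PreTopologicalGroup := {G of Group G & Topological G}.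

HB.mixin Record PreTopologicalGroup_isTopologicalGroup G
    & PreTopologicalGroup G := {
  gmul_continuous : continuous (fun x : G * G => (x.1 * x.2)%g) ;
  ginv_continuous : continuous (fun x : G => x^-1%g) ;
}.

#[short(type="topologicalGroupType")]
HB.structure Definition TopologicalGroup :=
  {G of PreTopologicalGroup G & PreTopologicalGroup_isTopologicalGroup G}.

Record dynSystem (R : realType) := DynSystem {
  ds_space : metricType R ;
  ds_group : topologicalGroupType ;
  ds_act : ds_group -> ds_space -> ds_space ;
  ds_compact : compact [set: ds_space] ;
  ds_act1 : forall x, ds_act 1%g x = x ;
  ds_actM : forall g h x, ds_act (g * h)%g x = ds_act g (ds_act h x) ;
  ds_act_continuous :
    continuous (fun gx : ds_group * ds_space => ds_act gx.1 gx.2) }.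

Definition ellis (R : realType) (S : dynSystem R) :
    set {ptws ds_space S -> ds_space S} :=
  closure (range (@ds_act R S) : set {ptws ds_space S -> ds_space S}).
Arguments ellis {R} S.

Section beta_rank.
Context {R : realType}.

Section oscillation.
Context {X : metricType R}.
Implicit Types (p : X -> X) (x : X) (A : set X).

Definition diam A : \bar R :=
  ereal_sup [set (mdist x y)%:E | x in A & y in A].

Definition osc p x A : \bar R :=
  ereal_inf [set diam (p @` (V `&` A)) | V in [set V | open_nbhs x V]].

Definition osc_deriv (eps : R) p A : set X :=
  [set x | A x /\ (eps%:E <= osc p x A)%E].

Definition osc_iter (eps : R) p : Ord -> set X := titer (osc_deriv eps p) setT.

Definition beta_eps p (eps : R) : Ord :=
  least [set a | (a < omega1)%O /\ osc_iter eps p a = set0].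

Definition beta p : Ord := osup [set beta_eps p eps | eps in [set e | 0 < e]].

End oscillation.

Definition beta_rank (S : dynSystem R) : Ord :=
  osup [set beta p | p in ellis S].

End beta_rank.

Definition is_homeo (X : topologicalType) (f : X -> X) : Prop :=
  exists g : X -> X,
    [/\ cancel f g, cancel g f, continuous f & continuous g].

(** [set_type] carries the subspace topology, here of the compact-open topology. *)
Definition homeo (X : topologicalType) : Type :=
  set_type [set f : {compact-open, X -> X} | is_homeo f].

HB.instance Definition _ (X : topologicalType) := Topological.on (homeo X).

Definition homeo_act (X : topologicalType) (f : homeo X) : X -> X := set_val f.

Section homeo_group.
Context {X : topologicalType}.
Implicit Types f g h : homeo X.

Definition Homeo (f : X -> X) (fP : is_homeo f) : homeo X :=
  exist _ (f : {compact-open, X -> X}) (mem_set fP).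

Lemma homeoP f : is_homeo (homeo_act f).
Proof. exact: set_mem (svalP f). Qed.

Lemma homeo_eq f g : homeo_act f =1 homeo_act g -> f = g.
Proof. by move=> fg; apply: val_inj; apply: funext. Qed.

Fact homeo_one_subproof : is_homeo (@idfun X).
Proof. by exists idfun; split => // x; exact: cvg_id. Qed.

Definition homeo_one : homeo X := Homeo homeo_one_subproof.

Fact homeo_mul_subproof f g : is_homeo (homeo_act f \o homeo_act g).
Proof.
have [f' [ff' f'f cf cf']] := homeoP f; have [g' [gg' g'g cg cg']] := homeoP g.
exists (g' \o f'); split.
- exact: can_comp.
- exact: can_comp.
- by move=> x; apply: continuous_comp; [exact: cg|exact: cf].
- by move=> x; apply: continuous_comp; [exact: cf'|exact: cg'].
Qed.

Definition homeo_mul f g : homeo X := Homeo (homeo_mul_subproof f g).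

Definition homeo_inv_fun f : X -> X := sval (cid (homeoP f)).

Fact homeo_inv_subproof f : is_homeo (homeo_inv_fun f).
Proof.
by exists (homeo_act f); have [] := svalP (cid (homeoP f)).
Qed.

Definition homeo_inv f : homeo X := Homeo (homeo_inv_subproof f).

Lemma homeo_invK f : cancel (homeo_act f) (homeo_act (homeo_inv f)).
Proof. by have [] := svalP (cid (homeoP f)). Qed.

Lemma homeo_Kinv f : cancel (homeo_act (homeo_inv f)) (homeo_act f).
Proof. by have [] := svalP (cid (homeoP f)). Qed.

Fact homeo_mulA : associative homeo_mul.
Proof. by move=> f g h; exact: homeo_eq. Qed.

Fact homeo_mul1 : left_id homeo_one homeo_mul.
Proof. by move=> f; exact: homeo_eq. Qed.

Fact homeo_1mul : right_id homeo_one homeo_mul.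
Proof. by move=> f; exact: homeo_eq. Qed.

Fact homeo_mulV : left_inverse homeo_one homeo_inv homeo_mul.
Proof. by move=> f; apply: homeo_eq => x; exact: homeo_invK. Qed.

Fact homeo_Vmul : right_inverse homeo_one homeo_inv homeo_mul.
Proof. by move=> f; apply: homeo_eq => x; exact: homeo_Kinv. Qed.

HB.instance Definition _ := isGroup.Build (homeo X)
  homeo_mulA homeo_mul1 homeo_1mul homeo_mulV homeo_Vmul.

End homeo_group.

Section homeo_system.
Context {R : realType} (X : metricType R) (cX : compact [set: X]).

Let hausX : hausdorff_space X. Proof. exact: metric_hausdorff. Qed.

Lemma homeo_act_continuous :
  continuous (fun gx : homeo X * X => homeo_act gx.1 gx.2).
Proof.
have -> : (fun gx : homeo X * X => homeo_act gx.1 gx.2) =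
    uncurry (@homeo_act X) by apply/funext => -[].
apply: continuous_uncurry_regular.
- by move=> x _; exists setT; [exact: filterT|split => //; exact: closedT].
- exact: uniform_regular.
- exact: initial_continuous.
- by move=> f; have [? []] := homeoP f.
Qed.

Let continuous_pair (T U V : topologicalType) (f : T -> U) (g : T -> V) x :
  {for x, continuous f} -> {for x, continuous g} ->
  {for x, continuous (fun z => (f z, g z))}.
Proof. exact: cvg_pair. Qed.

Lemma homeo_mul_continuous :
  continuous (fun fg : homeo X * homeo X => (fg.1 * fg.2)%g).
Proof.
apply: continuous_comp_initial.
apply: (@continuous_curry_fun _ _ _
  (fun z : (homeo X * homeo X) * X => homeo_act z.1.1 (homeo_act z.1.2 z.2))).
move=> [[f g] x].
apply: (@continuous_comp _ _ _
  (fun z : (homeo X * homeo X) * X => (z.1.1, homeo_act z.1.2 z.2))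
  (fun gx : homeo X * X => homeo_act gx.1 gx.2)); last exact: homeo_act_continuous.
apply: continuous_pair.
  by apply: cvg_comp; [exact: cvg_fst|exact: cvg_fst].
apply: (@continuous_comp _ _ _
  (fun z : (homeo X * homeo X) * X => (z.1.2, z.2))
  (fun gx : homeo X * X => homeo_act gx.1 gx.2)); last exact: homeo_act_continuous.
apply: continuous_pair; last exact: cvg_snd.
by apply: cvg_comp; [exact: cvg_fst|exact: cvg_snd].
Qed.

Lemma homeo_inv_continuous : continuous (fun f : homeo X => f^-1%g).
Proof.
apply: continuous_comp_initial => f.
have FF : Filter ((fun h : homeo X => homeo_act h^-1%g : {compact-open, X -> X})
    @ f) by apply: fmap_filter; exact: nbhs_filter.
apply: ((compact_open_cvgP _ FF).2) => K O cK oO fKO.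
have clK : closed K by exact: compact_closed.
have cO : compact (~` O).
  by apply: (@subclosed_compact _ _ setT) => //; exact: open_closedC.
have E (h : homeo X) : (homeo_act h^-1%g @` K `<=` O) =
    (homeo_act h @` (~` O) `<=` ~` K).
  apply/propext; split => H _ [x Kx <-].
    move=> Khx; apply: Kx; apply: H; exists (homeo_act h x) => //.
    exact: homeo_invK.
  apply: contrapT => Ohx; have := H x; apply => //.
  by exists (homeo_act h^-1%g x) => //; exact: homeo_Kinv.
have fO : homeo_act f @` (~` O) `<=` ~` K by rewrite -E.
have cv := @initial_continuous (homeo X) {compact-open, X -> X} set_val f.
have GF : Filter ((set_val : homeo X -> {compact-open, X -> X}) @ f).
  by apply: fmap_filter; exact: nbhs_filter.
have := (compact_open_cvgP _ GF).1 cv (~` O) (~` K) cO (closed_openC clK) fO.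
apply: (@filterS _ (nbhs f) _ (fun h => homeo_act h @` (~` O) `<=` ~` K)).
by move=> h; rewrite -E.
Qed.

HB.instance Definition _ := PreTopologicalGroup_isTopologicalGroup.Build
  (homeo X) homeo_mul_continuous homeo_inv_continuous.

Definition homeo_system : dynSystem R :=
  @DynSystem R X (homeo X) (@homeo_act X) cX (fun=> erefl) (fun _ _ _ => erefl)
    homeo_act_continuous.

End homeo_system.

(** The Euclidean plane: the library's product metric on [R * R] is the maximum
    metric. *)
Definition plane (R : realType) : Type := (R * R)%type.

HB.instance Definition _ (R : realType) := Choice.on (plane R).

Section plane_metric.
Context {R : realType}.
Implicit Types u v w : plane R.

Definition plane_dist u v : R :=
  Num.sqrt ((u.1 - v.1) ^+ 2 + (u.2 - v.2) ^+ 2).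

Fact plane_distxx u : plane_dist u u = 0.
Proof. by rewrite /plane_dist !subrr !expr0n/= addr0 sqrtr0. Qed.

Fact plane_dist_eq0 u v : plane_dist u v = 0 -> u = v.
Proof.
move=> /eqP; rewrite sqrtr_eq0 => uv0; apply/eqP; move: u v uv0 => [a b] [c d]/=.
rewrite xpair_eqE -!(subr_eq0 _ c) -!(subr_eq0 _ d) -!(sqrf_eq0 (_ - _)) => uv0.
have h1 := sqr_ge0 (a - c); have h2 := sqr_ge0 (b - d).
by rewrite !eq_le h1 h2 !andbT; apply/andP; split; lra.
Qed.

Fact plane_distC u v : plane_dist u v = plane_dist v u.
Proof. by congr Num.sqrt; ring. Qed.

Fact plane_dist_triangle v u w :
  plane_dist u w <= plane_dist u v + plane_dist v w.
Proof.
rewrite /plane_dist; set a := u.1 - v.1; set b := u.2 - v.2.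
set c := v.1 - w.1; set d := v.2 - w.2.
have -> : u.1 - w.1 = a + c by rewrite /a /c; ring.
have -> : u.2 - w.2 = b + d by rewrite /b /d; ring.
have ab0 : 0 <= a ^+ 2 + b ^+ 2 by rewrite addr_ge0 ?sqr_ge0.
have cd0 : 0 <= c ^+ 2 + d ^+ 2 by rewrite addr_ge0 ?sqr_ge0.
have s0 : 0 <= Num.sqrt (a ^+ 2 + b ^+ 2) + Num.sqrt (c ^+ 2 + d ^+ 2).
  by rewrite addr_ge0 ?sqrtr_ge0.
rewrite -(ger0_norm s0) -sqrtr_sqr ler_wsqrtr// [leRHS]sqrrD !sqr_sqrtr//.
rewrite -sqrtrM//.
have : a * c + b * d <= Num.sqrt ((a ^+ 2 + b ^+ 2) * (c ^+ 2 + d ^+ 2)).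
  apply: (le_trans (ler_norm _)); rewrite -sqrtr_sqr ler_wsqrtr//.
  by rewrite -subr_ge0 (_ : _ - _ = (a * d - b * c) ^+ 2) ?sqr_ge0//; ring.
by move: (Num.sqrt _) => t; lra.
Qed.

HB.instance Definition _ := isMetric.Build R (plane R)
  plane_distxx plane_dist_eq0 plane_distC plane_dist_triangle.

End plane_metric.

Section set_type_metric.
Context {R : realType} {X : metricType R} (A : set X).

Definition set_type_dist (x y : A) : R := mdist (val x) (val y).

Fact set_type_dist_ge0 x y : 0 <= set_type_dist x y.
Proof. exact: mdist_ge0. Qed.

Fact set_type_dist_eq0 x y : set_type_dist x y = 0 -> x = y.
Proof. by move/mdist_positivity/val_inj. Qed.

Fact set_type_ballE (x : A) d : ball x d = [set y | set_type_dist x y < d].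
Proof. by rewrite -initial_ballE ballEmdist. Qed.

HB.instance Definition _ := PseudoMetric_isMetric.Build R (A : Type)
  set_type_dist_ge0 set_type_dist_eq0 set_type_ballE.

End set_type_metric.

Lemma set_type_compact (X : topologicalType) (A : set X) :
  compact A -> compact [set: A].
Proof.
move=> cA F PF _.
have FA : ((val : A -> X) @ F) A.
  apply: (@filterS _ F _ setT); last exact: filterT.
  by move=> a _; exact: set_mem (svalP a).
have [x [Ax xF]] := cA _ (fmap_proper_filter _ PF) FA.
exists (exist _ x (mem_set Ax)); split => // B C FB.
rewrite nbhsE => -[_ [[W oW <-] Wx] WC].
have [||_ [[b Bb <-] Wb]] := xF (val @` B) W.
- by apply: (@filterS _ F _ B); [move=> b Bb; exists b|].
- exact: open_nbhs_nbhs.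
by exists b; split => //; exact: WC.
Qed.

Definition doubled_set (R : realType) (Y : set R) : set (plane R) :=
  [set u | Y u.1 /\ (u.2 = 0 \/ u.2 = 1)].

Definition doubled (R : realType) (Y : set R) : metricType R :=
  set_type (doubled_set Y).

Lemma doubled_compact (R : realType) (Y : set R) :
  compact Y -> compact [set: doubled Y].
Proof.
move=> cY; apply: set_type_compact.
pose e (i y : R) : plane R := (y, i).
have ce i : continuous (e i).
  move=> y; apply/metricType_numDomainType.cvgrPdist_lt => eps eps0.
  near=> z; rewrite /mdist/= /plane_dist/= subrr expr0n/= addr0 sqrtr_sqr.
  by near: z; apply: cvgr_dist_lt.
rewrite (_ : doubled_set Y = e 0 @` Y `|` e 1 @` Y).
  by apply: compactU; apply: continuous_compact => //;
    apply: continuous_subspaceT; exact: ce.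
apply/seteqP; split => [[y i] [/= Yy [i0|i1]]|_ [[y Yy <-]|[y Yy <-]]].
- by left; exists y => //; rewrite /e i0.
- by right; exists y => //; rewrite /e i1.
- by split=> //; left.
- by split=> //; right.
Unshelve. all: by end_near. Qed.

(* Main.v *)
Require Import Defs.
From HB Require Import structures.
From mathcomp Require Import all_boot all_order all_algebra.
From mathcomp Require Import all_classical all_reals all_analysis.

Set Implicit Arguments.
Unset Strict Implicit.
Unset Printing Implicit Defensive.

Import Order.TTheory GRing.Theory Num.Theory.
Import numFieldNormedType.Exports.

Local Open Scope classical_set_scope.
Local Open Scope ring_scope.

(** At a point of [Y] isolated in a Cantor-Bendixson derivative of [Y] every map
    has oscillation [0] relative to the preimage of that derivative, so the
    iterated oscillation sets lie over the derivatives: this bounds [beta p] by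
    [alpha] for every [p], since the last derivative of a countable compact
    space is empty.

    For the converse let [p] exchange the two copies of [Y] over the points of
    one parity of rank and fix everything else. [Y] being zero-dimensional, [p]
    agrees on any finite set with the exchange over a clopen set, which is a
    homeomorphism; hence [p] lies in the Ellis semigroup. Near every point of
    the derivative of order [a + 1] there are points of rank [a] and points of
    rank [a + 1], whose images under [p] from one copy lie in different copies;
    so the oscillation of [p] is at least [1] there, and the oscillation sets
    dominate the derivatives. *)

(** * Countable closed sets without isolated points *)

Section countable_compact.
Context {T : topologicalType}.
Hypotheses (hT : hausdorff_space T) (cT : compact [set: T]).

(** A Baire category argument: were [A] nonempty, shrinking open sets meeting [A] could discard its
    points one at a time along the enumeration [f], while compactness yields a cluster point in [A]
    that is never discarded. *)
Lemma countable_dense_in_itself_eq0 (A : set T) :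
  closed A -> countable A -> A `<=` limit_point A -> A = set0.
Proof.
move=> clA /countable_injP[f finj] Alim; apply/eqP/negPn/negP => /set0P A0.
(* The premises on [nU.2] stand inside the existential so that [choice] gives a total function. *)
have step (nU : nat * set T) : exists V : set T,
    open nU.2 -> nU.2 `&` A !=set0 -> [/\ open V, V `&` A !=set0,
      V `<=` nU.2 & forall q, A q -> f q = nU.1 -> ~ closure V q].
  case: nU => n U /=; have [[oU UA0]|] := pselect (open U /\ U `&` A !=set0);
    last by move=> h; exists set0 => oU UA0; exfalso; apply: h.
  pose W := U `&` ~` [set q | A q /\ f q = n].
  (* If the point at hand has index [n], being a limit point it has another point of [A] beside it,
     whose index differs. *)
  have [y [Uy Ay nyn]] : exists y, [/\ U y, A y & f y <> n].
    have [x [Ux Ax]] := UA0.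
    have [fx|] := pselect (f x = n); last by exists x.
    have [y [yx Ay Uy]] := Alim x Ax U (open_nbhs_nbhs (conj oU Ux)).
    exists y; split=> // fy; case/eqP: yx.
    by apply: finj; rewrite ?inE// fy fx.
  have oW : open W.
    apply: openI => //; apply: closed_openC.
    have [[q [Aq fq]]|nq] := pselect (exists q, A q /\ f q = n).
      suff -> : [set q | A q /\ f q = n] = [set q].
        exact/accessible_closed_set1/hausdorff_accessible.
      apply/seteqP; split=> [r [Ar fr]|r ->//].
      by apply: finj; rewrite ?inE// fq.
    suff -> : [set q | A q /\ f q = n] = set0 by exact: closed0.
    by apply/seteqP; split=> // q h; apply: nq; exists q.
  have Wy : nbhs y W by apply: open_nbhs_nbhs; split=> //; split=> // -[].
  have [B By BW] := compact_regular hT cT filterT Wy.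
  exists (interior B) => _ _; split.
  - exact: open_interior.
  - by exists y.
  - move=> z /interior_subset Bz.
    by have [] := BW z (subset_closure Bz).
  - move=> q Aq fq /(closure_subset (@interior_subset _ B))/BW[_].
    by apply.
have {step}[V VP] := choice step.
pose F := fix F n := if n is m.+1 then V (m, F m) else setT.
have FP n : open (F n) /\ F n `&` A !=set0.
  elim: n => [|n [oF FA]] /=.
    by split; [exact: openT|rewrite setTI].
  by have [] := VP (n, F n) oF FA.
have FS n : F n.+1 `<=` F n by have [oF FA] := FP n; have [] := VP (n, F n) oF FA.
have Fle n m : (n <= m)%N -> F m `<=` F n.
  elim: m => [|m IH]; first by rewrite leqn0 => /eqP ->.
  rewrite leq_eqVlt => /predU1P[-> //|]; rewrite ltnS => /IH h.
  exact: subset_trans (FS m) h.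
have [x xP] := choice (fun n => (FP n).2).
have [p [_ px]] := cT (fmap_proper_filter x eventually_filter) filterT.
have Fp n : closure (F n) p.
  move=> B Bp; apply: px => //.
  by exists n => // m /= nm; apply: (Fle _ _ nm); case: (xP m).
have Ap : A p.
  apply: clA => B Bp; apply: px => //.
  by exists 0%N => // m _ /=; case: (xP m).
have [oF FA] := FP (f p).
(* [F (f p).+1] is the stage whose closure was made to avoid [p]. *)
have [_ _ _ /(_ p Ap erefl)] := VP (f p, F (f p)) oF FA.
by apply; exact: (Fp (f p).+1).
Qed.

End countable_compact.

(** * Transfinite induction and decreasing iterations *)

Section iteration.
Local Open Scope order_scope.
Context {T : Type} (D : set T -> set T) (A : set T).

Lemma ordP (a : Ord) :
  [\/ a = Ord0, exists d, d < a /\ osucc d = a | is_limit a].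
Proof.
have [->|a0] := pselect (a = Ord0); first by constructor 1.
have [h|h] := pselect (exists d, d < a /\ osucc d = a); first by constructor 2.
by constructor 3; split=> // d da dE; apply: h; exists d.
Qed.

(** The successor case is asked only below [omega1], where [osucc] is the true successor. *)
Lemma ord_ind (P : Ord -> Prop) : P Ord0 ->
  (forall d, d < omega1 -> P d -> P (osucc d)) ->
  (forall a, is_limit a -> (forall d, d < a -> P d) -> P a) -> forall a, P a.
Proof.
move=> P0 PS Pl; apply: (well_founded_ind ord_wf) => a IH.
have [->//|[d [da <-]]|al] := ordP a; last exact: Pl.
by apply: PS; [exact: lt_le_trans da (le_omega1 _)|exact: IH].
Qed.

Lemma lt_osucc a : a < omega1 -> a < osucc a.
Proof. by move=> aw; rewrite osuccP. Qed.

Hypothesis Dsub : forall B, D B `<=` B.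

Lemma titer_decreasing a b : a <= b -> titer D A b `<=` titer D A a.
Proof.
elim/ord_ind: b a => [|b bw IH|b bl IH] a.
- by move=> a0; rewrite (_ : a = Ord0)//; apply/le_anti; rewrite a0 Ord0_le.
- rewrite le_eqVlt => /predU1P[->//|]; rewrite osuccP// => ab.
  by rewrite titerS// => x /(@Dsub _) /(IH _ ab).
- rewrite le_eqVlt => /predU1P[->//|ab].
  by rewrite (titer_lim _ _ bl) => x; apply.
Qed.

End iteration.

(** * Cantor-Bendixson derivatives and parity of rank *)

Section cantor_bendixson.
Local Open Scope order_scope.
Context {T : topologicalType}.

Lemma cb_deriv_sub (B : set T) : cb_deriv B `<=` B. Proof. by move=> x []. Qed.

Lemma cb_iter_decreasing a b : a <= b -> (cb_iter b : set T) `<=` cb_iter a.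
Proof. exact: titer_decreasing cb_deriv_sub _ _. Qed.

Lemma limit_pointS (B C : set T) : B `<=` C -> limit_point B `<=` limit_point C.
Proof. by move=> BC x Bx U /Bx[y [yx /BC Cy Uy]]; exists y. Qed.

Lemma dense_in_itself_cb_iter (B : set T) a :
  B `<=` limit_point B -> B `<=` cb_iter a.
Proof.
move=> Bl; rewrite /cb_iter; elim/ord_ind: a => [|a aw IH|a al IH].
- by rewrite titer0.
- by rewrite titerS// => x Bx; split; [exact: IH|exact: limit_pointS IH _ (Bl x Bx)].
- by rewrite (titer_lim _ _ al) => x Bx d da; exact: IH.
Qed.

Lemma closed_cb_iter a : accessible_space T -> closed (cb_iter a : set T).
Proof.
move=> T1; rewrite /cb_iter; elim/ord_ind: a => [|a aw IH|a al IH].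
- by rewrite titer0; exact: closedT.
- rewrite titerS//; apply: closedI => //; exact: limit_point_closed.
- by rewrite (titer_lim _ _ al); apply: closed_bigI => d; exact: IH.
Qed.

Lemma cb_rank_stable : cb_iter (cb_rank T) = cb_iter (osucc (cb_rank T)) :> set T.
Proof.
have [|//] := @leastP [set a | cb_iter a = cb_iter (osucc a) :> set T].
(* No element exceeds [omega1], so [osucc omega1] takes the default value [omega1] and the set
   defining the rank is nonempty. *)
exists omega1; congr cb_iter; apply/esym.
rewrite {1}/osucc (_ : [set b | omega1 < b] = set0) ?least_set0//.
by apply/seteqP; split=> // b /=; rewrite ltNge le_omega1.
Qed.

Lemma cb_rank_le a : a < omega1 -> cb_iter a = set0 :> set T -> cb_rank T <= a.
Proof.
move=> aw a0.
have aS : cb_iter a = cb_iter (osucc a) :> set T.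
  apply/seteqP; split; first by rewrite a0.
  by apply: cb_iter_decreasing; exact/ltW/lt_osucc.
have [|_ lb] := @leastP [set a | cb_iter a = cb_iter (osucc a) :> set T].
  by exists a.
exact: lb.
Qed.

(** The derivative at the rank is closed and consists of its own limit points, so countability makes
    it vanish. *)
Lemma cb_iter_rank : hausdorff_space T -> compact [set: T] ->
  countable [set: T] -> cb_rank T < omega1 -> cb_iter (cb_rank T) = set0 :> set T.
Proof.
move=> hT cT ctT aw; apply: countable_dense_in_itself_eq0 => //.
- exact/closed_cb_iter/hausdorff_accessible.
- exact: sub_countable (subset_card_le (@subsetT _ _)) ctT.
- by rewrite {1}cb_rank_stable /cb_iter titerS// => x [].
Qed.

Hypothesis scatteredT : exists2 g, g < omega1 & cb_iter g = set0 :> set T.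

(** Were there none, [U] would meet the derivative in a set dense in itself, which survives every
    stage, against [scatteredT]. *)
Lemma cb_iter_isolated_dense a (x : T) (U : set T) : a < omega1 ->
  cb_iter a x -> open_nbhs x U ->
  exists y, [/\ U y, cb_iter a y & ~ cb_iter (osucc a) y].
Proof.
move=> aw ax [oU Ux]; apply: contrapT => nex.
have [g _ g0] := scatteredT; suff : cb_iter g x by rewrite g0.
apply: (@dense_in_itself_cb_iter (U `&` cb_iter a)) => // y [Uy ay] V Vy.
have : cb_iter (osucc a) y by apply: contrapT => nay; apply: nex; exists y.
rewrite {1}/cb_iter titerS// => -[_ /(_ (U `&` V))].
case=> [|z [zy az [Uz Vz]]]; last by exists z.
by apply: filterI => //; apply: open_nbhs_nbhs.
Qed.

(** The successor of the Cantor-Bendixson rank of [x]. *)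
Definition exit (x : T) : Ord := least [set a | ~ cb_iter a x].

Lemma exitE a (x : T) : a < omega1 -> cb_iter a x -> ~ cb_iter (osucc a) x ->
  exit x = osucc a.
Proof.
move=> aw ax nax; have [|nex lb] := @leastP [set a | ~ cb_iter a x].
  by exists (osucc a).
apply/le_anti/andP; split; first exact: lb.
rewrite leNgt; apply/negP; rewrite osuccP// => le.
by apply: nex; apply: cb_iter_decreasing le _ ax.
Qed.

(** Complementing [set0] along the ordinals flips the value at each successor. *)
Definition odd_ord (a : Ord) : Prop := titer (@setC unit) set0 a tt.

Lemma odd_osucc a : a < omega1 -> odd_ord (osucc a) = ~ odd_ord a.
Proof. by move=> aw; rewrite /odd_ord titerS. Qed.

Definition odd_points : set T := [set x | odd_ord (exit x)].

(** The witnesses are isolated in two successive derivatives, so their values of [exit] are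
    consecutive and of opposite parity. *)
Lemma odd_points_dense a (x : T) (U : set T) : a < omega1 ->
  cb_iter (osucc a) x -> open_nbhs x U -> exists y z,
  [/\ U y /\ cb_iter a y, U z /\ cb_iter a z, odd_points y & ~ odd_points z].
Proof.
move=> aw ax Ux; have [g gw g0] := scatteredT.
(* A nonempty derivative comes before the empty one at [g]. *)
have saw : osucc a < omega1.
  apply: lt_trans gw; rewrite ltNge; apply/negP => /cb_iter_decreasing/(_ x ax).
  by rewrite g0.
have asub := @cb_iter_decreasing a _ (ltW (lt_osucc aw)).
have [y [Uy ay nay]] := cb_iter_isolated_dense aw (asub _ ax) Ux.
have [z [Uz az naz]] := cb_iter_isolated_dense saw ax Ux.
have oyz : odd_points z = ~ odd_points y.
  by rewrite /odd_points/= (exitE aw ay)// (exitE saw az)// (odd_osucc saw).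
have [oy|noy] := pselect (odd_points y); [exists y, z|exists z, y]; split=> //.
- by split=> //; exact: asub.
- by rewrite oyz; apply.
- by split=> //; exact: asub.
- by rewrite oyz.
Qed.

End cantor_bendixson.

(** * Clopen sets and zero-dimensionality *)

Lemma zero_dimensional_hausdorff (T : topologicalType) :
  zero_dimensional T -> hausdorff_space T.
Proof.
move=> zT; rewrite open_hausdorff => x y /zT[U [[oU cU] Ux Uy]].
exists (U, ~` U); rewrite /= ?in_setE; split => //; first exact: closed_openC.
by rewrite setICr.
Qed.

(** Induction on [s]: where the set found so far is wrong at the new point, a clopen neighbourhood
    of that point missing the rest of [s] is added or removed. *)
Lemma clopen_interpolation (T : topologicalType) (S : set T) (s : seq T) :
  zero_dimensional T ->
  exists2 C : set T, clopen C & forall x, x \in s -> C x <-> S x.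
Proof.
move=> zT; have sep (x : T) (t : seq T) : exists D : set T,
    [/\ clopen D, D x & forall y, y \in t -> y != x -> ~ D y].
  elim: t => [|z t [D [cD Dx Dt]]]; first by exists setT; split => //; exact: clopenT.
  have [->|zx] := eqVneq z x.
    exists D; split=> // y; rewrite inE => /orP[/eqP->|]; last exact: Dt.
    by rewrite eqxx.
  have [|E [cE Ex nEz]] := zT x z; first by rewrite eq_sym.
  exists (D `&` E); split=> //; first exact: clopenI.
  move=> y; rewrite inE => /orP[/eqP->|yt] yx []; first by move=> _ /nEz.
  by move=> /(Dt _ yt yx).
elim: s => [|x s [C cC CS]]; first by exists set0 => //; exact: clopen0.
have [CSx|nCSx] := pselect (C x <-> S x).
  by exists C => // y; rewrite inE => /orP[/eqP->//|]; exact: CS.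
(* Were [x] already in [s], the induction hypothesis would make [C] right at [x]. *)
have xs y : y \in s -> y != x by apply: contraTneq => ->; apply/negP => /CS.
have [D [cD Dx Ds]] := sep x s.
have [Sx|nSx] := pselect (S x).
- exists (C `|` D); first exact: clopenU.
  move=> y; rewrite inE => /orP[/eqP->|ys]; first by split=> // _; right.
  have nDy := Ds _ ys (xs _ ys).
  by rewrite -(CS y ys); split=> [[]//|]; left.
- exists (C `\` D); first by rewrite setDE; apply: clopenI => //; exact: clopenC.
  move=> y; rewrite inE => /orP[/eqP->|ys]; first by split=> // -[].
  have nDy := Ds _ ys (xs _ ys).
  by rewrite -(CS y ys); split=> [[]//|].
Qed.

(** A ball whose radius is not a distance from its centre to a point of [Y] is clopen in [Y];
    countably many distances cannot exhaust []0, r[], which has positive measure. *)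
Lemma countable_zero_dimensional (R : realType) (Y : set R) :
  countable Y -> zero_dimensional (set_type Y).
Proof.
move=> ctY x y xy; pose r := `|val x - val y|.
have r0 : 0 < r by rewrite normr_gt0 subr_eq0; apply: contra xy => /eqP/val_inj->.
pose D := [set `|z - val x| | z in Y].
have [t [t0 tr Dt]] : exists t : R, [/\ 0 < t, t < r & ~ D t].
  apply: contrapT => nt.
  have /countable_lebesgue_measure0 : countable (`]0, r[%classic : set R).
    apply: (@sub_countable _ _ _ D); last exact: sub_countable (card_image_le _ _) ctY.
    apply: subset_card_le => u /=; rewrite in_itv/= => /andP[u0 ur].
    by apply: contrapT => Du; apply: nt; exists u.
  rewrite lebesgue_measure_itv/= lte_fin r0 sube0 => -[r00].
  by move: r0; rewrite r00 ltxx.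
have cg : continuous (fun z : set_type Y => `|val z - val x|).
  have cd : continuous (fun u : R => `|u - val x|).
    move=> u; apply: (@cvg_norm _ R^o); apply: (@cvgB _ R^o); first exact: cvg_id.
    exact: cvg_cst.
  move=> z; apply: (@continuous_comp (set_type Y) R R val (fun u => `|u - val x|)).
    exact: (@initial_continuous (set_type Y) R val).
  exact: cd.
exists [set z : set_type Y | `|val z - val x| < t]; split.
- split; first by move/continuousP : cg => /(_ _ (@open_lt R t)).
  suff -> : [set z : set_type Y | `|val z - val x| < t] =
            [set z : set_type Y | `|val z - val x| <= t].
    by move/continuous_closedP : cg => /(_ _ (@closed_le R t)).
  apply/seteqP; split=> z /=; first exact: ltW.
  rewrite le_eqVlt => /predU1P[zt|//]; exfalso; apply: Dt.
  by exists (val z) => //; exact: (set_mem (valP z)).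
- by rewrite /= subrr normr0.
- by apply/negP; rewrite /= distrC -leNgt ltW.
Qed.

(** * The two copies of [Y] and the exchange maps *)

Section doubled_space.
Context {R : realType} {Y : set R}.
Notation X := (doubled Y).
Notation T := (set_type Y).

Fact base_subproof (x : X) : Y (val x).1.
Proof. by have [] := set_mem (valP x). Qed.

Definition base (x : X) : T := exist _ (val x).1 (mem_set (base_subproof x)).

Definition level (x : X) : bool := (val x).2 == 1.

Fact lift_subproof (b : bool) (y : T) : doubled_set Y ((val y, b%:R) : plane R).
Proof. by split; [exact: (set_mem (valP y))|case: b; [right|left]]. Qed.

Definition lift (b : bool) (y : T) : X :=
  exist _ ((val y, b%:R) : plane R) (mem_set (lift_subproof b y)).

Lemma base_lift b y : base (lift b y) = y. Proof. exact: val_inj. Qed.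

Lemma level_lift b y : level (lift b y) = b.
Proof. by case: b; rewrite /level/= ?eqxx// eq_sym oner_eq0. Qed.

Lemma val2_level (x : X) : (val x).2 = (level x)%:R.
Proof.
rewrite /level; have [_ /= [->|->]] := set_mem (valP x); last by rewrite eqxx.
by rewrite eq_sym oner_eq0.
Qed.

Lemma lift_level_base x : lift (level x) (base x) = x.
Proof. apply: val_inj => /=; rewrite -val2_level; exact/esym/surjective_pairing. Qed.

Lemma base_continuous : continuous base.
Proof.
suff c1 : continuous (fun x : X => (val x).1) by exact: continuous_comp_initial.
move=> x; apply/(cvgrPdist_lt (FF := nbhs_filter (x : X))) => e e0.
near=> y; have : mdist x y < e.
  by near: y; apply: metricType_numDomainType.cvgr_dist_lt.
apply: le_lt_trans; rewrite -sqrtr_sqr ler_wsqrtr// lerDl; exact: sqr_ge0.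
Unshelve. all: by end_near. Qed.

Lemma lift_continuous b : continuous (lift b).
Proof.
suff cp : continuous (fun y : T => (val y, b%:R) : plane R).
  exact: continuous_comp_initial.
move=> y; apply/(metricType_numDomainType.cvgrPdist_lt (FF := nbhs_filter y)) => e e0.
near=> z; rewrite /mdist/= /plane_dist/= subrr expr0n/= addr0 sqrtr_sqr.
near: z; apply: cvgr_dist_lt => //.
exact: (@initial_continuous T R val).
Unshelve. all: by end_near. Qed.

Lemma mdist_level (x y : X) : level x -> ~~ level y -> 1 <= mdist x y.
Proof.
move=> lx /negPf ly; rewrite /mdist/= /set_type_dist /mdist/= /plane_dist.
rewrite (val2_level x) (val2_level y) lx ly subr0 expr1n.
by rewrite -[leLHS]sqrtr1 ler_wsqrtr// lerDr sqr_ge0.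
Qed.

(** The unit ball about [x] stays in the copy containing [x]. *)
Lemma level_locally_constant (x : X) : \forall y \near x, level y = level x.
Proof.
near=> y; have : mdist x y < 1.
  by near: y; apply: metricType_numDomainType.cvgr_dist_lt.
have yx := @mdist_level y x; have xy := @mdist_level x y.
case: (level x) (level y) yx xy => [] [] // yx xy; rewrite ltNge.
  by rewrite xy.
by rewrite metric_sym yx.
Unshelve. all: by end_near. Qed.
(** [S] is arbitrary, to cover both homeomorphisms ([S] clopen) and their possibly discontinuous
    limits. *)
Definition flip (S : set T) (x : X) : X := lift (level x (+) `[< S (base x) >]) (base x).

Lemma flipK S : involutive (flip S).
Proof.
move=> x; rewrite /flip base_lift level_lift -addbA addbb addbF.
exact: lift_level_base.
Qed.

Lemma level_flip S b y : level (flip S (lift b y)) = b (+) `[< S y >].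
Proof. by rewrite /flip level_lift level_lift base_lift. Qed.

Lemma flip_eq S C x : (C (base x) <-> S (base x)) -> flip C x = flip S x.
Proof. by move=> CS; rewrite /flip (asbool_equiv_eq CS). Qed.

(** Near [x] both the level and membership in [C] are constant, so the map is locally
    [lift b \o base] for a fixed [b]. *)
Lemma flip_continuous C : clopen C -> continuous (flip C).
Proof.
move=> [oC cC] x; pose b := level x (+) `[< C (base x) >].
have fx : flip C x = (lift b \o base) x by [].
suff h : {near x, lift b \o base =1 flip C}.
  apply: cvg_trans (near_eq_cvg h) _; rewrite fx.
  by apply: continuous_comp; [exact: base_continuous|exact: lift_continuous].
have Cloc : \forall y \near x, `[< C (base y) >] = `[< C (base x) >].
  have [Cx|nCx] := pselect (C (base x)).
    have : nbhs x (base @^-1` C).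
      by apply: base_continuous; apply: open_nbhs_nbhs; split.
    by apply: filterS => y /= Cy; apply: asbool_equiv_eq.
  have : nbhs x (base @^-1` (~` C)).
    by apply: base_continuous; apply: open_nbhs_nbhs; split=> //; exact: closed_openC.
  by apply: filterS => y /= Cy; apply: asbool_equiv_eq.
near=> y; rewrite /flip/=; congr (lift (_ (+) _) _).
- by apply/esym; near: y; exact: level_locally_constant.
- by apply/esym; near: y.
Unshelve. all: by end_near. Qed.

Lemma flip_homeo C : clopen C -> is_homeo (flip C).
Proof.
by move=> cC; exists (flip C); split; try exact: flipK; exact: flip_continuous.
Qed.

(** The sets [B s], made of exchanges over clopen sets agreeing with [S] on the finite list [s],
    generate a filter converging pointwise to [flip S]: the list [[:: base x]] already fixes the
    value at [x]. *)
Lemma flip_ellis (cY : compact Y) S : countable Y ->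
  ellis (homeo_system (doubled_compact cY)) (flip S).
Proof.
move=> ctY; pose B (s : seq T) := [set flip C | C in
  [set C | clopen C /\ forall x, x \in s -> C x <-> S x]].
have BF : ProperFilter (filter_from [set: seq T] B).
  apply: filter_from_proper; last first.
    move=> s _.
    have [C cC CS] := clopen_interpolation S s (countable_zero_dimensional ctY).
    by exists (flip C), C.
  apply: filter_fromT_filter; first by exists nil.
  move=> s t; exists (s ++ t) => f [C [cC CS] <-].
  by split; exists C => //; split=> // x xs; apply: CS; rewrite mem_cat xs ?orbT.
rewrite /ellis closureEcvg.
exists (filter_from [set: seq T] B : set_system {ptws X -> X}) => //; split.
  apply/pointwise_cvgP => x U Ux.
  exists [:: base x] => // f [C [cC CS] <-] /=.
  rewrite (@flip_eq S)//; first exact: nbhs_singleton.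
  by apply: CS; rewrite inE.
move=> E rE; exists nil => // f [C [cC _] <-]; apply: rE.
by exists (Homeo (flip_homeo cC)).
Qed.

End doubled_space.

(** * Comparison of oscillation sets with derivatives *)

Section oscillation_rank.
Context {R : realType} (Y : set R).
Notation X := (doubled Y).
Notation T := (set_type Y).

Lemma osc_iter_sub_cb_iter (eps : R) (p : X -> X) a : 0 < eps ->
  osc_iter eps p a `<=` base @^-1` (cb_iter a : set T).
Proof.
move=> eps0; rewrite /osc_iter /cb_iter; elim/ord_ind: a => [|a aw IH|a al IH].
- by rewrite !titer0.
- rewrite !titerS// => x [ax oscx]; split; first exact: IH.
  apply: contrapT; rewrite not_limit_pointE => -[U Ux Uiso].
  (* The level condition removes the twin of [x] in the other copy, which [base] does not
     distinguish from [x]. *)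
  pose V := interior ((base @^-1` U) `&` [set y | level y = level x]).
  have Vx : open_nbhs x V.
    split; first exact: open_interior.
    apply: filterI; first exact: base_continuous.
    exact: level_locally_constant.
  have Vsub y : (V `&` titer (osc_deriv eps p) setT a) y -> y = x.
    move=> [/interior_subset[/= Uy ly] ay].
    rewrite -(lift_level_base y) -(lift_level_base x) ly; congr lift.
    by apply: Uiso; split=> //; exact: IH.
  have : (osc p x (titer (osc_deriv eps p) setT a) <= 0)%E.
    apply: (@le_trans _ _ (diam (p @` (V `&` titer (osc_deriv eps p) setT a)))).
      by apply: ereal_inf_lbound; exists V.
    apply: ge_ereal_sup => _ [_ [y /Vsub -> <-]] [_ [z /Vsub -> <-] <-].
    by rewrite mdistxx.
  by move=> /(le_trans oscx); rewrite lee_fin leNgt eps0.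
- by rewrite !(titer_lim _ _ al) => x ax d da; apply: IH => //; exact: ax.
Qed.

Hypothesis scatteredT : exists2 g, (g < omega1)%O & cb_iter g = set0 :> set T.

Lemma cb_iter_sub_osc_iter a :
  base @^-1` (cb_iter a : set T) `<=` osc_iter 1 (flip (@odd_points T)) a.
Proof.
rewrite /osc_iter; elim/ord_ind: a => [|a aw IH|a al IH].
- by rewrite titer0.
- rewrite titerS// => x /= ax; split.
    by apply: IH; apply: cb_iter_decreasing ax; exact/ltW/lt_osucc.
  apply: le_ereal_inf_tmp => _ [V [oV Vx] <-].
  (* Pulling [V] back along the lift to the level of [x] places both witnesses in the copy
     containing [x]. *)
  have [|y [z [[Vy ay] [Vz az] oy noz]]] :=
    @odd_points_dense _ scatteredT a (base x) (lift (level x) @^-1` V) aw ax.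
    split; last by rewrite /= lift_level_base.
    by move/continuousP : (@lift_continuous R Y (level x)) => /(_ _ oV).
  set q := flip _.
  set W := q @` _.
  have far u v : level u -> ~~ level v -> W u -> W v -> (1 <= diam W)%E.
    move=> lu lv qu qv; apply: (@le_trans _ _ (mdist u v)%:E).
      by rewrite lee_fin mdist_level.
    by apply: ereal_sup_ubound; exists u => //; exists v.
  have qV t : (lift (level x) @^-1` V) t -> cb_iter a t ->
      W (q (lift (level x) t)).
    move=> Vt at_; exists (lift (level x) t) => //; split=> //.
    by apply: IH; rewrite /= base_lift.
  have ly : level (q (lift (level x) y)) = ~~ level x.
    by rewrite level_flip asboolT// addbT.
  have lz : level (q (lift (level x) z)) = level x.
    by rewrite level_flip asboolF// addbF.
  have qy := qV y Vy ay; have qz := qV z Vz az.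
  (* The map moves the lift of [y] and keeps that of [z], so the level of [x] decides which image is
     in the upper copy. *)
  have [lx|lx] := boolP (level x).
    by apply: (far _ _ _ _ qz qy); rewrite ?ly ?lz ?lx.
  by apply: (far _ _ _ _ qy qz); rewrite ?ly ?lz ?lx.
- rewrite (titer_lim _ _ al) => x ax d da; apply: IH => //=.
  by move: ax; rewrite /= {1}/cb_iter (titer_lim _ _ al); exact.
Qed.

End oscillation_rank.

Theorem theorem5p5 (R : realType) (alpha : Ord) (alpha_lt : (alpha < omega1)%O)
    (Y : set R) (Y01 : Y `<=` `[0, 1]) (cY : compact Y) (ctY : countable Y)
    (rkY : cb_rank (set_type Y) = alpha) :
  beta_rank (homeo_system (doubled_compact cY)) = alpha.
Proof.
have Yalpha : cb_iter alpha = set0 :> set (set_type Y).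
  rewrite -rkY; apply: cb_iter_rank; rewrite ?rkY//.
  - exact/zero_dimensional_hausdorff/countable_zero_dimensional.
  - exact: set_type_compact.
  - have [f finj] := countable_injP _ ctY.
    apply/countable_injP; exists (f \o val) => u v _ _ fuv.
    by apply: val_inj; apply: finj fuv; exact: valP.
have osc0 (p : doubled Y -> doubled Y) eps : 0 < eps ->
    osc_iter eps p alpha = set0.
  move=> eps0; apply/seteqP; split=> // x /(osc_iter_sub_cb_iter eps0).
  by rewrite Yalpha.
apply/le_anti/andP; split.
  apply: (osupP _).2 => _ [p _ <-]; apply: (osupP _).2 => _ [eps /= eps0 <-].
  (* [alpha] is a candidate in the definition of [beta_eps], so the least one is at most [alpha]. *)
  by apply: (leastP _).2; [exists alpha; split|split] => //; exact: osc0.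
pose p : doubled Y -> doubled Y := flip (@odd_points (set_type Y)).
apply: (@le_trans _ _ (beta p)); last first.
  by apply: (osupP _).1; exists p => //; exact: flip_ellis.
(* The value [1] is the gap between the two copies. *)
apply: (@le_trans _ _ (beta_eps p 1)); last first.
  by apply: (osupP _).1; exists 1 => //=; exact: ltr01.
rewrite /beta_eps; set A := (X in least X).
(* Since [alpha] is a member, [least A] is a genuine stage with empty oscillation set, not the
   default [omega1]. *)
have [|[bw b0] _] := @leastP A; first by exists alpha; split=> //; exact: osc0.
rewrite -rkY; apply: cb_rank_le => //.
apply/seteqP; split=> // y by_.
(* The choice of the copy [true] is arbitrary. *)
have : osc_iter 1 p (least A) (lift true y).
  by apply: cb_iter_sub_osc_iter; [exists alpha|rewrite /= base_lift].
by rewrite b0.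
Qed.
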